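(* Let $p$ be a prime and $q$ a power of $p$. For every integer $m\ge 2$, the orthogonal group $\mathrm{O}(2m+1,\overline{\mathbb{F}_q})$ is not acceptable.
   Context: $\overline{\mathbb{F}_q}$ denotes an algebraic closure of the finite field $\mathbb{F}_q$. Let $\Lambda_m$ be the $m\times m$ matrix with $1$'s on the antidiagonal and $0$ elsewhere, fix $\alpha\in\mathbb{F}_q^\times$, and let $J_o=\begin{pmatrix}0&0&\Lambda_m\\0&\alpha&0\\\Lambda_m&0&0\end{pmatrix}$. Then $\mathrm{O}(2m+1,\overline{\mathbb{F}_q})=\{A\in\mathrm{GL}(2m+1,\overline{\mathbb{F}_q}) : {}^tAJ_oA=J_o\}$. Let $\Gamma$ be a group and $H$ a finite group. Two homomorphisms $\phi_1,\phi_2:H\to\Gamma$ are element-conjugate if for every $x\in H$ there is $h(x)\in\Gamma$ with $\phi_1(x)=h(x)^{-1}\phi_2(x)h(x)$; they are globally conjugate if one can choose a single $h\in\Gamma$ with $\phi_1(x)=h^{-1}\phi_2(x)h$ for all $x\in H$. The group $\Gamma$ is acceptable if for every finite group $H$, any two element-conjugate homomorphisms $H\to\Gamma$ are globally conjugate. *)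

(* Defs.v *)
From HB Require Import structures.
From mathcomp Require Import all_boot all_order all_algebra all_fingroup.

Set Implicit Arguments.
Unset Strict Implicit.
Unset Printing Implicit Defensive.

Import GRing.Theory.
Local Open Scope ring_scope.

Section Acceptability.
Local Open Scope group_scope.

Definition element_conjugate (H : finGroupType) (G : groupType)
    (phi1 phi2 : {multiplicative H -> G}) : Prop :=
  forall x : H, exists h : G, phi1 x = h^-1 * phi2 x * h.

Definition globally_conjugate (H : finGroupType) (G : groupType)
    (phi1 phi2 : {multiplicative H -> G}) : Prop :=
  exists h : G, forall x : H, phi1 x = h^-1 * phi2 x * h.

Definition acceptable (G : groupType) : Prop :=
  forall (H : finGroupType) (phi1 phi2 : {multiplicative H -> G}),
    element_conjugate phi1 phi2 -> globally_conjugate phi1 phi2.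

End Acceptability.

Section IsometryGroup.
Variables (K : fieldType) (n : nat) (J : 'M[K]_n).

Definition preserves_form : pred 'M[K]_n :=
  [pred A | (A \in unitmx) && (A^T *m J *m A == J)].

(* J is not assumed nondegenerate, so invertibility of A is imposed. *)
Definition isometry_group : Type := {A : 'M[K]_n | preserves_form A}.

HB.instance Definition _ := Choice.on isometry_group.

Fact isometry_mul_subproof (A B : isometry_group) : preserves_form (val A *m val B).
Proof.
case: A B => [A /= /andP[uA /eqP JA]] [B /= /andP[uB /eqP JB]].
rewrite /preserves_form /= unitmx_mul uA uB /= trmx_mul.
by rewrite -!mulmxA (mulmxA J) (mulmxA A^T) (mulmxA A^T J) JA mulmxA JB.
Qed.

Fact isometry_one_subproof : preserves_form 1%:M.
Proof. by rewrite /preserves_form /= unitmx1 trmx1 mul1mx mulmx1 eqxx. Qed.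

Fact isometry_inv_subproof (A : isometry_group) : preserves_form (invmx (val A)).
Proof.
case: A => [A /= /andP[uA /eqP JA]]; rewrite /preserves_form /= unitmx_inv uA /=.
by rewrite -{1}JA !mulmxA -trmx_mul mulmxV // trmx1 mul1mx -mulmxA mulmxV ?mulmx1.
Qed.

Definition isometry_mul (A B : isometry_group) : isometry_group :=
  Sub (val A *m val B) (isometry_mul_subproof A B).
Definition isometry_one : isometry_group := Sub 1%:M isometry_one_subproof.
Definition isometry_inv (A : isometry_group) : isometry_group :=
  Sub (invmx (val A)) (isometry_inv_subproof A).

Fact isometry_mulA : associative isometry_mul.
Proof. by move=> A B C; apply/val_inj; rewrite /= mulmxA. Qed.

Fact isometry_mul1g : left_id isometry_one isometry_mul.
Proof. by move=> A; apply/val_inj; rewrite /= mul1mx. Qed.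

Fact isometry_mulg1 : right_id isometry_one isometry_mul.
Proof. by move=> A; apply/val_inj; rewrite /= mulmx1. Qed.

Fact isometry_mulVg : left_inverse isometry_one isometry_inv isometry_mul.
Proof.
by move=> A; apply/val_inj; rewrite /= mulVmx //; case/andP: (valP A).
Qed.

Fact isometry_mulgV : right_inverse isometry_one isometry_inv isometry_mul.
Proof.
by move=> A; apply/val_inj; rewrite /= mulmxV //; case/andP: (valP A).
Qed.

HB.instance Definition _ := isGroup.Build isometry_group
  isometry_mulA isometry_mul1g isometry_mulg1 isometry_mulVg isometry_mulgV.

End IsometryGroup.

Section OddOrthogonal.
Variables (K : fieldType) (m : nat).

Definition antidiag_mx : 'M[K]_m := \matrix_(i, j) (j == rev_ord i)%:R.

(* The size 2m+1 is written m + (1 + m) so that the 3 x 3 block shape of the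
   form is literal:
      (   0     0   Lambda )
      (   0   alpha   0    )
      ( Lambda  0     0    )  *)
Definition Jo (alpha : K) : 'M[K]_(m + (1 + m)) :=
  block_mx 0                      (row_mx 0 antidiag_mx)
           (col_mx 0 antidiag_mx) (block_mx alpha%:M 0
                                            0        0).

Definition orthogonal_group (alpha : K) : groupType := isometry_group (Jo alpha).

End OddOrthogonal.

Arguments orthogonal_group {K} m alpha.

(* K, with the embedding iota : F -> K, is an algebraic closure of F; algebraic
   closedness itself is part of closedFieldType. *)
Definition is_algebraic_closure (F : fieldType) (K : closedFieldType)
  (iota : {rmorphism F -> K}) : Prop := integralRange iota.

(* Main.v *)
Require Import Defs.
From HB Require Import structures.
From mathcomp Require Import all_boot all_order all_algebra all_fingroup.
From mathcomp Require Import ring zify.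

(** Finite groups of commuting unipotent isometries defeat acceptability: two such
    groups may well be conjugate one element at a time while spanning linear
    spaces of matrices of different shapes.

    Let (a, d) and (b, c) be two hyperbolic pairs of indices of the symmetric
    form J; the form of size 2m+1 has them as soon as m >= 2.  On the span of
    these four vectors, which is the tensor product of two symplectic planes,
    two copies of SL2 act by isometries.  The corresponding root vectors X and
    Y are commuting square-zero skew matrices, and
         u(x, y) = (1 + x X) (1 + y Y) = 1 + x X + y Y + x y X Y
    is a homomorphism from pairs of scalars to isometries of J.  This makes
    sense in every characteristic, 2 included, because no exponential with a
    denominator occurs.

    Take H = F^2, a finite additive group, and t in K outside F.  The forms
    x(i, j) = i + j t and y(i, j) = i + j (t + 1) are additive and injective on
    H, so phi1 = u(x, x) and phi2 = u(x, y) are homomorphisms from H.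

    - They are element-conjugate: the torus of the second SL2 fixes X and
      rescales Y by an arbitrary square, hence by an arbitrary nonzero scalar
      as K is algebraically closed, so u(x, x) and u(x, y) are conjugate
      whenever x and y are nonzero ([pair_rep_element_conjugate]).
    - They are not globally conjugate: simultaneous conjugation preserves linear
      relations between the matrices phi(h).  With g = (1, 0) and h = (0, 1),
         (t + 1) phi(g) - (t + 1) phi(h) + (t - 1) phi(g + h) = t - 1
      holds for phi1, since it reduces to two polynomial identities in t (for
      the functions x and x^2).  For phi2, the coefficient of X Y on the left is
      (t + 1) (t - y(h)) = - (t + 1), which is nonzero
      ([pair_rep_not_globally_conjugate]). *)

Set Implicit Arguments.
Unset Strict Implicit.
Unset Printing Implicit Defensive.

Import GRing.Theory.
Local Open Scope ring_scope.

(** * Algebraically closed fields *)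

Lemma closed_field_sqrt (K : closedFieldType) (z : K) : exists s : K, s ^+ 2 = z.
Proof.
have [s] : exists s, root ('X^2 - z%:P) s by apply/closed_rootP; rewrite size_XnsubC.
by rewrite rootE !hornerE subr_eq0 => /eqP <-; exists s.
Qed.

(** The polynomial [X * \prod_i (X - f i) + 1] takes the value 1 at every [f i],
    so any of its roots avoids the image of [f]; the factor [X] keeps it
    nonconstant when [F] is empty. *)
Lemma closed_field_not_finite (F : finType) (K : closedFieldType) (f : F -> K) :
  exists t : K, forall i, t != f i.
Proof.
pose P := \prod_(i : F) ('X - (f i)%:P) * 'X + 1.
have sP : size P != 1%N.
  have nz : \prod_(i : F) ('X - (f i)%:P) != 0.
    by apply/prodf_neq0 => i _; rewrite polyXsubC_eq0.
  by rewrite /P size_polyDl size_mulX ?size_poly1 ?ltnS ?lt0n ?eqSS ?size_poly_eq0.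
have /closed_rootP[t rt] := sP.
exists t => i; apply: contraTneq rt => ->.
rewrite /P rootE (bigD1 i) //= !hornerE subrr !mul0r add0r.
exact: oner_neq0.
Qed.

(** * Unipotent isometries from square-zero skew matrices *)

Section SquareZero.
Variables (K : fieldType) (n : nat) (J : 'M[K]_n).

(** Skewness with respect to [J] is membership in the Lie algebra of the isometry
    group; together with [X *m X = 0] it makes [1 + x X] itself an isometry. *)
Definition square_zero_skew (X : 'M[K]_n) : Prop :=
  X *m X = 0 /\ X^T *m J = - (J *m X).

(** The linear terms of [(1 + x X)^T J (1 + x X)] cancel by skewness, and the
    quadratic term is [X^T J X = - J X X = 0]. *)
Fact unipotent_subproof (X : 'M[K]_n) (hX : square_zero_skew X) (x : K) :
  preserves_form J (1%:M + x *: X).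
Proof.
case: hX => XX XJ; apply/andP; split.
  suff /mulmx1_unit[] : (1%:M + x *: X) *m (1%:M - x *: X) = 1%:M by [].
  rewrite mulmxDl mul1mx mulmxBr mulmx1 -scalemxAl -scalemxAr XX !scaler0 subr0.
  by rewrite subrK.
have -> : (1%:M + x *: X)^T = 1%:M + x *: X^T.
  by apply/matrixP=> i j; rewrite !mxE eq_sym.
rewrite mulmxDl mul1mx mulmxDr mulmx1 -scalemxAl XJ.
rewrite -scalemxAr mulmxDl -scalemxAl mulNmx -[J *m X *m X]mulmxA XX mulmx0.
by rewrite oppr0 scaler0 addr0 scalerN subrK.
Qed.

Definition unipotent X (hX : square_zero_skew X) (x : K) : isometry_group J :=
  Sub (1%:M + x *: X) (unipotent_subproof hX x).

Lemma unipotentD X (hX : square_zero_skew X) x y :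
  unipotent hX (x + y) = (unipotent hX x * unipotent hX y)%g.
Proof.
apply/val_inj; rewrite /= mulmxDl mul1mx mulmxDr mulmx1 -scalemxAl -scalemxAr.
by case: hX => -> _; rewrite !scaler0 addr0 scalerDl addrA addrAC.
Qed.

Lemma unipotentC X Y (hX : square_zero_skew X) (hY : square_zero_skew Y) x y :
  X *m Y = Y *m X ->
  (unipotent hX x * unipotent hY y = unipotent hY y * unipotent hX x)%g.
Proof.
move=> XY; apply/val_inj; rewrite /= !mulmxDl !mulmxDr !mul1mx !mulmx1.
by rewrite -!scalemxAl -!scalemxAr XY !scalerA mulrC -!addrA [X in _ + X]addrCA.
Qed.

Section Pair.
Variables (X Y : 'M[K]_n) (hX : square_zero_skew X) (hY : square_zero_skew Y).
Hypothesis XY : X *m Y = Y *m X.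

Definition bi_unipotent (x y : K) : isometry_group J :=
  (unipotent hX x * unipotent hY y)%g.

Lemma val_bi_unipotent x y :
  val (bi_unipotent x y) =
    1%:M + x *: X + y *: Y + (x * y) *: (X *m Y) :> 'M[K]_n.
Proof.
rewrite /= mulmxDl mul1mx mulmxDr mulmx1 -scalemxAl -scalemxAr scalerA.
by rewrite -!addrA; congr (_ + _); rewrite addrCA.
Qed.

Lemma bi_unipotentD x y x' y' :
  bi_unipotent (x + x') (y + y') = (bi_unipotent x y * bi_unipotent x' y')%g.
Proof.
rewrite /bi_unipotent !unipotentD -!mulgA; congr (_ * _)%g.
by rewrite !mulgA (unipotentC _ _ _ _ XY).
Qed.

Fact pair_rep_subproof (H : finZmodType) (x y : {additive H -> K}) :
  {morph (fun h : H => bi_unipotent (x h) (y h)) : g h / (g * h)%g}.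
Proof. by move=> g h; rewrite !raddfD bi_unipotentD. Qed.

(** [h |-> u(x h, y h)], a homomorphism since [bi_unipotent] is additive in the
    pair of its arguments. *)
Definition pair_rep (H : finZmodType) (x y : {additive H -> K}) :
    {multiplicative H -> isometry_group J} :=
  HB.pack_for {multiplicative H -> isometry_group J}
    (fun h : H => bi_unipotent (x h) (y h))
    (isMultiplicative.Build H (isometry_group J) _ (pair_rep_subproof x y)).

(** An element commuting with [X] and scaling [Y] by a square acts on the second
    parameter alone; this is what makes element-conjugacy cheap. *)
Lemma bi_unipotent_conj (T : isometry_group J) (s x y : K) :
    val T *m X = X *m val T -> val T *m Y = s ^+ 2 *: (Y *m val T) ->
  bi_unipotent x y = (T^-1 * bi_unipotent x (s ^+ 2 * y) * T)%g.
Proof.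
move=> TX TY.
suff eqT : (T * bi_unipotent x y = bi_unipotent x (s ^+ 2 * y) * T)%g.
  by rewrite -mulgA -eqT mulKg.
apply/val_inj; change (val T *m val (bi_unipotent x y) =
  val (bi_unipotent x (s ^+ 2 * y)) *m val T).
rewrite !val_bi_unipotent !mulmxDl !mulmxDr mulmx1 mul1mx -!scalemxAl -!scalemxAr.
have TXY : val T *m (X *m Y) = s ^+ 2 *: (X *m Y *m val T).
  by rewrite mulmxA TX -mulmxA TY -scalemxAr mulmxA.
rewrite TX TY TXY !scalerA.
by congr (_ + _ + _ *: _ + _ *: _); ring.
Qed.

End Pair.

(** * Two homomorphisms, conjugate elementwise but not globally *)

Section PairRepresentations.
Variables (X Y : 'M[K]_n) (hX : square_zero_skew X) (hY : square_zero_skew Y).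
Hypothesis XY : X *m Y = Y *m X.
Variables (H : finZmodType) (x y : {additive H -> K}).

(** Injectivity makes [x h] and [y h] nonzero away from [0], and then a torus
    element with [s ^+ 2 = y h / x h] conjugates [u(x h, x h)] to
    [u(x h, y h)].  The element depends on [h] through this ratio. *)
Lemma pair_rep_element_conjugate :
    (forall z : K, exists s, s ^+ 2 = z) ->
    (forall s : K, s != 0 -> exists T : isometry_group J,
      val T *m X = X *m val T /\ val T *m Y = s ^+ 2 *: (Y *m val T)) ->
    injective x -> injective y ->
  element_conjugate (pair_rep hX hY XY x x) (pair_rep hX hY XY x y).
Proof.
move=> sqrtK torus injx injy h.
have [-> | h_neq0] := eqVneq h 0.
  by exists 1%g; rewrite /= !raddf0 invg1 mulg1 mul1g.
have xh : x h != 0 by rewrite raddf_eq0.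
have yh : y h != 0 by rewrite raddf_eq0.
have [s s2] := sqrtK (y h / x h).
have s_neq0 : s != 0 by rewrite -sqrf_eq0 s2 mulf_neq0 ?invr_eq0.
have [T [TX TY]] := torus s s_neq0; exists T.
by rewrite /= (bi_unipotent_conj hX hY _ _ TX TY) s2 divfK.
Qed.

(** The coefficients [t + 1], [- (t + 1)], [t - 1] come from solving for a linear
    relation between the pairs [(x, x ^+ 2)] at [x = 1], [t] and [1 + t].  The resulting relation between matrices is invariant under
    conjugation, its right-hand side being scalar, and reading it at an entry
    [(i, j)] that sees only [X *m Y] gives [(t + 1) * (t - y h) = 0]. *)
Lemma pair_rep_not_globally_conjugate (g h : H) (i j : 'I_n) :
    i != j -> X i j = 0 -> Y i j = 0 -> (X *m Y) i j != 0 ->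
    x g = 1 -> y g = 1 -> x h != -1 -> x h != y h ->
  ~ globally_conjugate (pair_rep hX hY XY x x) (pair_rep hX hY XY x y).
Proof.
move=> ij Xij Yij XYij xg yg xh1 xhy [T conjT].
pose t := x h.
pose M (f : H -> isometry_group J) : 'M[K]_n :=
  (t + 1) *: val (f g) - (t + 1) *: val (f h) + (t - 1) *: val (f (g + h)).
have M1 : M (pair_rep hX hY XY x x) = (t - 1)%:M.
  rewrite /M /pair_rep !val_bi_unipotent [x (g + h)]raddfD xg -/t -[RHS]scalemx1.
  move: (X *m Y) => Z; apply/matrixP=> k l; rewrite !mxE; ring.
have M2 : M (pair_rep hX hY XY x y) = (t - 1)%:M.
  have uT : val T \in unitmx by case/andP: (valP T).
  apply: (can_inj (mulmxK uT)); rewrite -scalar_mxC -M1.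
  have TM k : val T *m val (pair_rep hX hY XY x x k) =
              val (pair_rep hX hY XY x y k) *m val T.
    by rewrite conjT; change (val (T * (T^-1 * pair_rep hX hY XY x y k * T)) =
      val (pair_rep hX hY XY x y k * T))%g; rewrite mulgA mulKVg.
  rewrite /M !(mulmxDl, mulmxDr, mulNmx, mulmxN).
  by rewrite -!scalemxAl -!scalemxAr !TM.
have /matrixP/(_ i j) := M2.
rewrite /M /pair_rep !val_bi_unipotent [x (g + h)]raddfD [y (g + h)]raddfD xg yg -/t.
move: XYij; move: (X *m Y) => Z Zij.
rewrite !mxE Xij Yij (negPf ij) !mulr0n => E.
(* With [y g = 1] and [s = y h], the coefficient of [Z] is
   [(t + 1) - (t + 1) t s + (t - 1) (1 + t) (1 + s) = (t + 1) (t - s)]. *)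
have : (t + 1) * (t - y h) * Z i j = 0 by rewrite -[RHS]E; ring.
by apply/eqP; rewrite !mulf_neq0 // ?subr_eq0 ?addr_eq0.
Qed.

End PairRepresentations.

End SquareZero.

(** * Root vectors and torus attached to two hyperbolic pairs *)

Section HyperbolicPlanes.
Variables (K : fieldType) (n : nat) (J : 'M[K]_n).

Definition hyperbolic_pair (i j : 'I_n) : Prop :=
  forall k, J k i = (k == j)%:R /\ J k j = (k == i)%:R.

Lemma mulmx_delta_pair (i j k : 'I_n) : hyperbolic_pair i j ->
  J *m delta_mx i k = delta_mx j k /\ J *m delta_mx j k = delta_mx i k.
Proof.
move=> hij; split; apply/matrixP=> p q; rewrite !mxE.
  rewrite (bigD1 i) //= big1 ?addr0 => [|l li].
    by rewrite mxE eqxx (hij p).1 -natrM mulnb.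
  by rewrite mxE (negPf li) mulr0.
rewrite (bigD1 j) //= big1 ?addr0 => [|l lj].
  by rewrite mxE eqxx (hij p).2 -natrM mulnb.
by rewrite mxE (negPf lj) mulr0.
Qed.

Variables a b c d : 'I_n.
Hypotheses (symJ : J^T = J) (uniq_abcd : uniq [:: a; b; c; d]).
Hypotheses (Had : hyperbolic_pair a d) (Hbc : hyperbolic_pair b c).

(** The positive root vectors of the two commuting copies of SL2 in the
    orthogonal group of the four-dimensional split space: as roots of D2, these
    are [e1 + e2] and [e1 - e2]. *)
Definition root_vec1 : 'M[K]_n := delta_mx b d - delta_mx a c.
Definition root_vec2 : 'M[K]_n := delta_mx c d - delta_mx a b.

Let neqs :
  ((((a == b) = false) * ((a == c) = false) * ((a == d) = false)) *
   (((b == c) = false) * ((b == d) = false) * ((c == d) = false)) *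
   (((b == a) = false) * ((c == a) = false) * ((d == a) = false)) *
   (((c == b) = false) * ((d == b) = false) * ((d == c) = false)))%type.
Proof.
rewrite (eq_sym b a) (eq_sym c a) (eq_sym d a) (eq_sym c b) (eq_sym d b).
rewrite (eq_sym d c); move: uniq_abcd.
rewrite /= !inE !negb_or !andbT.
case/and3P=> /and3P[/negPf ab /negPf ac /negPf ad] /andP[/negPf bc /negPf bd].
by move=> /negPf cd; rewrite ab ac ad bc bd cd.
Qed.

Let mul_delta (i j k l : 'I_n) :
  delta_mx i j *m delta_mx k l = (if j == k then delta_mx i l else 0) :> 'M[K]_n.
Proof. by rewrite mul_delta_mx_cond; case: eqP. Qed.

Local Ltac delta_simp :=
  rewrite !(mulmxDl, mulmxDr, mulNmx, mulmxN, mul_delta, neqs, eqxx,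
            oppr0, addr0, add0r, opprK).

Lemma root_vec1_skew : square_zero_skew J root_vec1.
Proof.
split; first by rewrite /root_vec1; delta_simp.
have -> : root_vec1^T *m J = (J *m root_vec1)^T by rewrite trmx_mul symJ.
rewrite /root_vec1 mulmxBr (mulmx_delta_pair _ Had).1 (mulmx_delta_pair _ Hbc).1.
by rewrite raddfB /= !trmx_delta opprB.
Qed.

Lemma root_vec2_skew : square_zero_skew J root_vec2.
Proof.
split; first by rewrite /root_vec2; delta_simp.
have -> : root_vec2^T *m J = (J *m root_vec2)^T by rewrite trmx_mul symJ.
rewrite /root_vec2 mulmxBr (mulmx_delta_pair _ Had).1 (mulmx_delta_pair _ Hbc).2.
by rewrite raddfB /= !trmx_delta opprB.
Qed.

Lemma root_vec_mul : root_vec1 *m root_vec2 = - delta_mx a d.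
Proof. by rewrite /root_vec1 /root_vec2; delta_simp. Qed.

Lemma root_vecC : root_vec1 *m root_vec2 = root_vec2 *m root_vec1.
Proof. by rewrite root_vec_mul /root_vec1 /root_vec2; delta_simp. Qed.

(** The coordinate projections to the spans of {a, c} and {b, d}, which the form
    puts in duality: an isometry scaling one by [s] must scale the other by
    [s^-1]. *)
Let proj1 : 'M[K]_n := delta_mx a a + delta_mx c c.
Let proj2 : 'M[K]_n := delta_mx b b + delta_mx d d.

(** The cocharacter of the second SL2: it commutes with the first SL2. *)
Definition torus_mx (s : K) : 'M[K]_n :=
  1%:M + (s - 1) *: proj1 + (s^-1 - 1) *: proj2.

Lemma torus_mx_invK (s : K) : s != 0 -> torus_mx s^-1 *m torus_mx s = 1%:M.
Proof.
move=> s0; rewrite /torus_mx invrK.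
have PP : proj1 *m proj1 = proj1 by rewrite /proj1; delta_simp.
have QQ : proj2 *m proj2 = proj2 by rewrite /proj2; delta_simp.
have PQ : proj1 *m proj2 = 0 by rewrite /proj1 /proj2; delta_simp.
have QP : proj2 *m proj1 = 0 by rewrite /proj1 /proj2; delta_simp.
rewrite !mulmxDl !mulmxDr !mul1mx !mulmx1 -!scalemxAl -!scalemxAr PP QQ PQ QP.
rewrite !scaler0; move: proj1 proj2 => P Q.
by apply/matrixP=> i j; rewrite !mxE; field.
Qed.

Fact torus_subproof (s : K) (s0 : s != 0) : preserves_form J (torus_mx s).
Proof.
have symP : proj1^T = proj1 by rewrite /proj1 raddfD /= !trmx_delta.
have symQ : proj2^T = proj2 by rewrite /proj2 raddfD /= !trmx_delta.
have JP : J *m proj1 = proj2 *m J.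
  rewrite -symJ -symQ -trmx_mul symJ mulmxDr (mulmx_delta_pair _ Had).1.
  rewrite (mulmx_delta_pair _ Hbc).2 mulmxDr (mulmx_delta_pair _ Had).2.
  by rewrite (mulmx_delta_pair _ Hbc).1 raddfD /= !trmx_delta addrC.
have JQ : J *m proj2 = proj1 *m J.
  by rewrite -[proj1]symP -[J in RHS]symJ -trmx_mul JP trmx_mul symJ symQ.
apply/andP; split; first by case/mulmx1_unit: (torus_mx_invK s0).
have symT : (torus_mx s)^T = torus_mx s.
  rewrite /torus_mx -{2}symP -{2}symQ; move: proj1 proj2 => P Q.
  by apply/matrixP=> i j; rewrite !mxE eq_sym.
have TJ : torus_mx s *m J = J *m torus_mx s^-1.
  rewrite /torus_mx invrK !mulmxDl !mulmxDr mul1mx mulmx1 -!scalemxAl -!scalemxAr.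
  by rewrite JP JQ addrAC.
by rewrite symT TJ -mulmxA torus_mx_invK // mulmx1.
Qed.

Lemma torus_root_vec (s : K) : s != 0 -> exists T : isometry_group J,
  val T *m root_vec1 = root_vec1 *m val T /\
  val T *m root_vec2 = s ^+ 2 *: (root_vec2 *m val T).
Proof.
move=> s0; exists (Sub (torus_mx s) (torus_subproof s0)); rewrite SubK.
have PX : proj1 *m root_vec1 = root_vec1 *m proj1.
  by rewrite /proj1 /root_vec1; delta_simp.
have QX : proj2 *m root_vec1 = root_vec1 *m proj2.
  by rewrite /proj2 /root_vec1; delta_simp.
have PY : proj1 *m root_vec2 = root_vec2.
  by rewrite /proj1 /root_vec2; delta_simp; rewrite addrC.
have YP : root_vec2 *m proj1 = 0 by rewrite /proj1 /root_vec2; delta_simp.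
have QY : proj2 *m root_vec2 = 0 by rewrite /proj2 /root_vec2; delta_simp.
have YQ : root_vec2 *m proj2 = root_vec2.
  by rewrite /proj2 /root_vec2; delta_simp; rewrite addrC.
(* The projections and root vectors are made opaque, lest distributivity expand
   them. *)
rewrite /torus_mx; move: proj1 proj2 root_vec1 root_vec2 PX QX PY YP QY YQ.
move=> P Q X Y PX QX PY YP QY YQ.
split; rewrite !mulmxDl !mulmxDr mul1mx mulmx1 -!scalemxAl -!scalemxAr ?PX ?QX //.
rewrite PY YP QY YQ !scaler0.
by apply/matrixP=> i j; rewrite !mxE; field.
Qed.

End HyperbolicPlanes.

(** * Failure of acceptability *)

Section AffineForm.
Variables (F K : fieldType) (iota : {rmorphism F -> K}) (t : K).

Definition affine_form (h : 'rV[F]_2) : K := iota (h 0 0) + iota (h 0 1) * t.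

Fact affine_form_is_nmod_morphism : nmod_morphism affine_form.
Proof.
split=> [|g h]; rewrite /affine_form !mxE; first by rewrite rmorph0 mul0r addr0.
by rewrite !rmorphD mulrDl addrACA.
Qed.

HB.instance Definition _ := GRing.isNmodMorphism.Build 'rV[F]_2 K
  affine_form affine_form_is_nmod_morphism.

(** A nontrivial relation [i + j * t = 0] would express [t] as [- i / j]. *)
Lemma affine_form_inj : (forall i, t != iota i) -> injective affine_form.
Proof.
move=> tF; apply: raddf_inj => h /=; rewrite /affine_form => E.
have h1 : h 0 1 = 0.
  apply: contraTeq isT => h1; case/eqP: (tF (- h 0 0 / h 0 1)).
  apply: (mulIf (x := iota (h 0 1))); first by rewrite fmorph_eq0.
  rewrite -rmorphM /= divfK // rmorphN mulrC.
  by apply/eqP; rewrite -addr_eq0 addrC E.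
have /eqP : iota (h 0 0) = 0 by rewrite -E h1 rmorph0 mul0r addr0.
rewrite fmorph_eq0 => /eqP h0; apply/rowP=> k; rewrite mxE.
by case: k => -[|[|//]] lt_k; [rewrite -[RHS]h0|rewrite -[RHS]h1]; congr (h _ _);
  apply/val_inj.
Qed.

Lemma affine_form_delta0 : affine_form (delta_mx 0 0) = 1.
Proof. by rewrite /affine_form !mxE /= rmorph1 rmorph0 mul0r addr0. Qed.

Lemma affine_form_delta1 : affine_form (delta_mx 0 1) = t.
Proof. by rewrite /affine_form !mxE /= rmorph1 rmorph0 mul1r add0r. Qed.

End AffineForm.

(** The second parameter [t + 1] is chosen so that it avoids [F] like [t], while
    [t - (t + 1) = -1] is nonzero in every characteristic. *)
Theorem hyperbolic_planes_not_acceptable (F : finFieldType)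
    (K : closedFieldType) (iota : {rmorphism F -> K}) (n : nat) (J : 'M[K]_n)
    (a b c d : 'I_n) :
    J^T = J -> uniq [:: a; b; c; d] ->
    hyperbolic_pair J a d -> hyperbolic_pair J b c ->
  ~ acceptable (isometry_group J).
Proof.
move=> symJ abcd Had Hbc acc.
have hX := root_vec1_skew symJ abcd Had Hbc.
have hY := root_vec2_skew symJ abcd Had Hbc.
have XY := root_vecC K abcd.
have [ab ac ad] : [/\ a != b, a != c & a != d].
  by move: abcd; rewrite /= !inE !negb_or => /andP[/and3P[]].
have bd : b != d by move: abcd; rewrite /= !inE !negb_or => /and3P[_ /andP[]].
have cd : c != d by move: abcd; rewrite /= !inE => /and4P[].
have [t tF] := closed_field_not_finite iota.
have t1F i : t + 1 != iota i.
  by apply: contra (tF (i - 1)) => /eqP E; rewrite rmorphB rmorph1 -E addrK.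
pose x : {additive 'rV[F]_2 -> K} := affine_form iota t.
pose y : {additive 'rV[F]_2 -> K} := affine_form iota (t + 1).
apply: (@pair_rep_not_globally_conjugate K n J _ _ hX hY XY _ x y
  (delta_mx 0 0) (delta_mx 0 1) a d ad).
- by rewrite !mxE (negPf ab) (eq_sym d) (negPf cd) andbF subr0.
- by rewrite !mxE (negPf ac) (eq_sym d) (negPf bd) andbF subr0.
- by rewrite (root_vec_mul K abcd) !mxE !eqxx oppr_eq0 oner_neq0.
- exact: affine_form_delta0.
- exact: affine_form_delta0.
- by rewrite /x /= affine_form_delta1 -(rmorph1 iota) -rmorphN tF.
- by rewrite /x /y /= !affine_form_delta1 eq_sym -subr_eq0 addrC addKr oner_neq0.
apply: acc; apply: pair_rep_element_conjugate.
- exact: closed_field_sqrt.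
- exact: (torus_root_vec symJ abcd Had Hbc).
- exact: affine_form_inj.
- exact: affine_form_inj.
Qed.

(** The block decomposition is invisible to [rev_ord]; this formula over the whole
    index type is what symmetry and the hyperbolic pairs are read from. *)
Lemma Jo_coef (K : fieldType) m (alpha : K) i j :
  Jo m alpha i j =
    (j == rev_ord i)%:R * (if nat_of_ord i == m then alpha else 1).
Proof.
have rev_ordE k (u v : 'I_k) : (v == rev_ord u) = (u + v + 1 == k)%N.
  by rewrite -val_eqE /=; have := ltn_ord u; have := ltn_ord v; lia.
rewrite rev_ordE; set e := (_ == _)%N; set w := if _ then _ else _.
have off : ~~ e -> 0 = e%:R * w by move/negPf->; rewrite mul0r.
have anti : i != m :> nat -> forall e' : bool, e' = e -> e'%:R = e%:R * w.
  by rewrite /w => /negPf-> _ ->; rewrite mulr1.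
rewrite /Jo /antidiag_mx !mxE.
case: splitP => i' Ei; rewrite ?mxE; case: splitP => j' Ej; rewrite ?mxE.
- by apply: off; rewrite /e; have := ltn_ord i'; have := ltn_ord j'; lia.
- case: splitP => k Ek; rewrite !mxE ?rev_ordE; have := ltn_ord i'; have := ltn_ord k.
    by move=> *; apply: off; rewrite /e; lia.
  by move=> *; apply: anti; rewrite ?/e; lia.
- case: splitP => k Ek; rewrite !mxE ?rev_ordE; have := ltn_ord j'; have := ltn_ord k.
    by move=> *; apply: off; rewrite /e; lia.
  by move=> *; apply: anti; rewrite ?/e; lia.
- case: splitP => k Ek; rewrite !mxE; case: splitP => l El; rewrite !mxE;
    have := ltn_ord k; have := ltn_ord l => lt_l lt_k; last 3 first.
  1-3: by apply: off; rewrite /e; lia.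
  rewrite !ord1 mulr1n /w /e ifT; last lia.
  by rewrite (_ : (_ == _)%N = true) ?mul1r //; lia.
Qed.

Lemma Jo_sym (K : fieldType) m (alpha : K) : (Jo m alpha)^T = Jo m alpha.
Proof.
apply/matrixP=> i j; rewrite mxE !Jo_coef eq_sym (can2_eq rev_ordK rev_ordK).
case: eqP => [->|]; rewrite ?mul0r //; congr (_ * _).
by have := ltn_ord i => /= lt_i; congr (if _ then _ else _); lia.
Qed.

Lemma Jo_hyperbolic_pair (K : fieldType) m (alpha : K) i :
  nat_of_ord i != m -> hyperbolic_pair (Jo m alpha) i (rev_ord i).
Proof.
move=> im k; rewrite !Jo_coef (inj_eq rev_ord_inj) [k == _]eq_sym.
rewrite (can2_eq (@rev_ordK _) (@rev_ordK _)) [k == i]eq_sym.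
split; case: eqP => [ik|]; rewrite ?mul0r ?mul1r // ifN //; last by rewrite -ik.
by apply: contra im => /eqP km; rewrite ik /= km; lia.
Qed.

Theorem theorem6p7 (p q : nat) (hp : prime p)
    (hq : exists2 k : nat, (0 < k)%N & q = (p ^ k)%N)
    (F : finFieldType) (hF : #|F| = q)
    (K : closedFieldType) (iota : {rmorphism F -> K})
    (hK : is_algebraic_closure iota)
    (alpha : F) (halpha : alpha != 0)
    (m : nat) (hm : (2 <= m)%N) :
  ~ acceptable (orthogonal_group m (iota alpha)).
Proof.
have m0 : (0 < m + (1 + m))%N by lia.
have m1 : (1 < m + (1 + m))%N by lia.
pose a := Ordinal m0; pose b := Ordinal m1.
apply: (@hyperbolic_planes_not_acceptable F K iota _ _ a b (rev_ord b) (rev_ord a)).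
- exact: Jo_sym.
- by rewrite /= !inE -!val_eqE /=; lia.
- by apply: Jo_hyperbolic_pair; rewrite /=; lia.
- by apply: Jo_hyperbolic_pair; rewrite /=; lia.
Qed.
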